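(* Let $\boldsymbol{A}\boldsymbol{x}+\boldsymbol{B}\boldsymbol{z}\le\boldsymbol{b}$ be a compact (extended) formulation of the convex hull of the nonempty set $\{\boldsymbol{x}\in\{0,1\}^n:\boldsymbol{C}\boldsymbol{x}\le\boldsymbol{d}\}$. Then a linear programming formulation of the constrained assortment problem $$\max\Bigl\{\frac{\sum_{j\in N}r_ju_jx_j}{u_0+\sum_{j\in N}u_jx_j}\ :\ \boldsymbol{C}\boldsymbol{x}\le\boldsymbol{d},\ \boldsymbol{x}\in\{0,1\}^n\Bigr\}$$ is $$\max\Bigl\{\sum_{j\in N}r_ju_jy_j\ :\ \boldsymbol{A}\boldsymbol{y}+\boldsymbol{B}\boldsymbol{z}\le\boldsymbol{b}\,y_0,\ y_0\ge0,\ u_0y_0+\sum_{j\in N}u_jy_j=1\Bigr\},$$ where the maximum is over $(y_0,\boldsymbol{y},\boldsymbol{z})$; i.e. the two problems have the same optimal value.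
   Context: $N=\{1,\dots,n\}$; $r_j$ is the revenue from selling product $j$; $u_j\ge0$ ($j\in N$) and $u_0>0$ are preference weights on product $j$ and on no purchase; $\boldsymbol{C}$ is a $k\times n$ matrix and $\boldsymbol{d}\in\mathbb{R}^k$. A system $\boldsymbol{A}\boldsymbol{x}+\boldsymbol{B}\boldsymbol{z}\le\boldsymbol{b}$ with $\boldsymbol{z}\in\mathbb{R}^q$ is an extended formulation of a polytope $P\subseteq\mathbb{R}^n$ if $P=\{\boldsymbol{x}:\exists\boldsymbol{z}\in\mathbb{R}^q,\ \boldsymbol{A}\boldsymbol{x}+\boldsymbol{B}\boldsymbol{z}\le\boldsymbol{b}\}$; it is compact if $q$ and the number of inequalities are polynomial in $n$. *)

(* Defs.v *)
From mathcomp Require Export all_boot all_order all_algebra.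
From mathcomp Require Export classical_sets reals convex.

Set Implicit Arguments.
Unset Strict Implicit.
Unset Printing Implicit Defensive.

Import Order.TTheory GRing.Theory Num.Theory.
Local Open Scope classical_set_scope.
Local Open Scope ring_scope.

Definition le_cv (R : realType) (m : nat) (x y : 'cV[R]_m) : Prop :=
  forall i, x i 0 <= y i 0.
Notation "x <=v y" := (le_cv x y) (at level 70) : ring_scope.

Definition binary (R : realType) (n : nat) : set 'cV[R]_n :=
  [set x | forall j, x j 0 = 0 \/ x j 0 = 1].
Arguments binary {R n}.

Definition assortments (R : realType) (n k : nat)
    (C : 'M[R]_(k, n)) (d : 'cV[R]_k) : set 'cV[R]_n :=
  [set x | C *m x <=v d /\ binary x].

Definition expected_revenue (R : realType) (n : nat)
    (r u : 'I_n -> R) (u0 : R) (x : 'cV[R]_n) : R :=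
  (\sum_(j < n) r j * u j * x j 0) / (u0 + \sum_(j < n) u j * x j 0).

Definition convex_hull (R : realType) (n : nat) (S : set 'cV[R]_n)
    : set 'cV[R]_n :=
  smallest (@convex_set R 'cV[R]_n) S.

Definition extended_formulation (R : realType) (n q m : nat)
    (A : 'M[R]_(m, n)) (B : 'M[R]_(m, q)) (b : 'cV[R]_m)
    (P : set 'cV[R]_n) : Prop :=
  P = [set x | exists z : 'cV[R]_q, A *m x + B *m z <=v b].

(* Being polynomial in n is a property of a family of systems: a family is
   compact when one polynomial p bounds the numbers of extra variables and of
   inequalities of every member.  The polynomial is therefore a parameter. *)
Definition compact_extended_formulation (R : realType) (p : {poly nat})
    (n q m : nat) (A : 'M[R]_(m, n)) (B : 'M[R]_(m, q)) (b : 'cV[R]_m)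
    (P : set 'cV[R]_n) : Prop :=
  extended_formulation A B b P /\ (q <= p.[n]%R)%N /\ (m <= p.[n]%R)%N.

Definition lp_feasible (R : realType) (n q m : nat)
    (A : 'M[R]_(m, n)) (B : 'M[R]_(m, q)) (b : 'cV[R]_m)
    (u : 'I_n -> R) (u0 : R) : set (R * 'cV[R]_n * 'cV[R]_q) :=
  [set w | let: (y0, y, z) := w in
    [/\ A *m y + B *m z <=v y0 *: b, 0 <= y0
      & u0 * y0 + \sum_(j < n) u j * y j 0 = 1]].

Definition lp_objective (R : realType) (n q : nat) (r u : 'I_n -> R)
    (w : R * 'cV[R]_n * 'cV[R]_q) : R :=
  let: (_, y, _) := w in \sum_(j < n) r j * u j * y j 0.

Definition is_max_value (R : realType) (T : Type) (f : T -> R) (X : set T)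
    (v : R) : Prop :=
  (f @` X) v /\ ubound (f @` X) v.

(* Main.v *)
Require Import Defs.
From HB Require Import structures.
From mathcomp Require Import boolp interval_inference ring lra.

(** Write [R(x)] for the revenue [sum_j r_j u_j x_j], [D(x)] for the denominator
    [u0 + sum_j u_j x_j], which is positive on assortments, and let [v] be the
    best ratio [R(x) / D(x)], attained at an assortment [x'] because there are
    only finitely many of them ([binary_argmax]).

    The value [v] is reached by the linear program through the Charnes-Cooper
    substitution: dividing [(1, x', z')] by [D(x')] gives a feasible point
    ([charnes_cooper]).

    It is also an upper bound.  The inequality [R(x) / D(x) <= v] says that the
    linear function [L(x) = sum_j (r_j - v) u_j x_j] is at most [v u0]; being
    linear, this inequality passes to the convex hull ([convex_hull_weight_le]).
    For a feasible [(y0, y, z)] one wants the homogenized inequality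
    [L(y) <= v u0 y0], which together with [u0 y0 + sum_j u_j y_j = 1] is
    exactly [R(y) <= v].  If [y0 > 0], one could divide by [y0]; if [y0 = 0], the
    vector [y] is only a recession direction of the hull.  Both cases are treated
    at once by adding the point [(1, x', z')] to [(y0, y, z)]: then
    [(y + x') / (y0 + 1)] lies in the hull, so [L(y) + L(x') <= v u0 (y0 + 1)],
    and [L(x') = v u0] since [x'] attains [v] ([homogenized_weight_le]). *)

Set Implicit Arguments.
Unset Strict Implicit.
Unset Printing Implicit Defensive.

Import Order.TTheory GRing.Theory Num.Theory.
Local Open Scope classical_set_scope.
Local Open Scope ring_scope.

Definition weight (R : realType) (n : nat) (c : 'I_n -> R) (x : 'cV[R]_n) : R :=
  \sum_(j < n) c j * x j 0.

Lemma weight_is_linear (R : realType) (n : nat) (c : 'I_n -> R) :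
  scalar (weight c).
Proof.
move=> a x y; rewrite /weight mulr_sumr -big_split /=.
by apply: eq_bigr => j _; rewrite !mxE; ring.
Qed.

HB.instance Definition _ (R : realType) (n : nat) (c : 'I_n -> R) :=
  GRing.isLinear.Build R 'cV[R]_n R *%R (weight c) (@weight_is_linear R n c).

Lemma weight_lin (R : realType) (n : nat) (c e : 'I_n -> R) (s : R)
    (x : 'cV[R]_n) :
  weight (fun j => c j - s * e j) x = weight c x - s * weight e x.
Proof.
rewrite /weight mulr_sumr -sumrB; apply: eq_bigr => j _; ring.
Qed.

(** The half-space [weight c x <= a] is itself a convex set containing [S]. *)
Lemma convex_hull_weight_le (R : realType) (n : nat) (S : set 'cV[R]_n)
    (c : 'I_n -> R) (a : R) :
  (forall x, S x -> weight c x <= a) ->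
  forall x, convex_hull S x -> weight c x <= a.
Proof.
move=> Sle; apply: (@smallest_sub _ _ _ [set x | weight c x <= a]) => //.
move=> x y t; rewrite !inE /= => xa ya.
change (weight c (t%:num *: x + (1 - t%:num) *: y) <= a).
rewrite linearD !linearZ /=.
have t0 : 0 <= t%:num by [].
have t1 : t%:num <= 1 by [].
nra.
Qed.

(** A binary vector is the indicator of a subset of the finite index type, so
    the maximum is taken over finitely many subsets. *)
Lemma binary_argmax (R : realType) (n : nat) (X : set 'cV[R]_n)
    (f : 'cV[R]_n -> R) :
  X `<=` binary -> X !=set0 ->
  exists2 x, X x & forall y, X y -> f y <= f x.
Proof.
move=> Xbin [x0 Xx0].
pose ind (E : {set 'I_n}) : 'cV[R]_n := \col_j (j \in E)%:R.
have indP x : X x -> ind [set j | x j 0 == 1]%SET = x.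
  move=> /Xbin xbin; apply/colP => j; rewrite !mxE inE.
  by case: (xbin j) => ->; rewrite ?eqxx // eq_sym oner_eq0.
pose E0 := [set j | x0 j 0 == 1]%SET.
have P0 : `[< X (ind E0) >] by apply/asboolP; rewrite indP.
case: (@Order.TotalTheory.arg_maxP _ _ _ E0 (fun E => `[< X (ind E) >])
         (fun E => f (ind E)) P0) => E /asboolP XE Emax.
exists (ind E) => // y Xy; rewrite -(indP y Xy).
by apply: Emax; apply/asboolP; rewrite indP.
Qed.

Lemma le_cvZ (R : realType) (m : nat) (a : R) (x y : 'cV[R]_m) :
  0 <= a -> x <=v y -> a *: x <=v a *: y.
Proof. by move=> a0 xy i; rewrite !mxE ler_wpM2l. Qed.

Lemma le_cvD (R : realType) (m : nat) (x y x' y' : 'cV[R]_m) :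
  x <=v y -> x' <=v y' -> x + x' <=v y + y'.
Proof. by move=> xy xy' i; rewrite !mxE lerD. Qed.

(** A linear inequality on [P] that is tight at some point [x'] of [P]
    homogenizes to the cone of solutions of [A y + B z <= y0 b]: adding the
    lift of [x'], which has [y0 = 1], moves any such solution, including one
    with [y0 = 0], to a positive level where it can be scaled back into [P],
    and by tightness the added term cancels. *)
Lemma homogenized_weight_le (R : realType) (n q m : nat)
    (A : 'M[R]_(m, n)) (B : 'M[R]_(m, q)) (b : 'cV[R]_m) (P : set 'cV[R]_n)
    (c : 'I_n -> R) (a : R) (x' y : 'cV[R]_n) (y0 : R) (z : 'cV[R]_q) :
  extended_formulation A B b P ->
  (forall x, P x -> weight c x <= a) -> P x' -> weight c x' = a ->
  0 <= y0 -> A *m y + B *m z <=v y0 *: b ->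
  weight c y <= a * y0.
Proof.
move=> defP Ple Px' cx' y0_ge0 yz.
have [z' xz'] : exists z', A *m x' + B *m z' <=v b.
  by move: Px'; rewrite defP.
have s_gt0 : 0 < y0 + 1 by rewrite ltr_wpDl.
have : P ((y0 + 1)^-1 *: (y + x')).
  rewrite defP; exists ((y0 + 1)^-1 *: (z + z')).
  rewrite -!scalemxAr -scalerDr !mulmxDr addrACA.
  rewrite -[b](scalerK (lt0r_neq0 s_gt0)); apply: le_cvZ.
    by rewrite invr_ge0 ltW.
  by rewrite scalerDl scale1r; apply: le_cvD.
move=> /Ple; rewrite linearZ linearD /= cx' ler_pdivrMl // mulrC.
by rewrite mulrDr mulr1 lerD2r.
Qed.

(** The Charnes-Cooper substitution [y0 = 1 / D(x)], [y = y0 x]. *)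
Lemma charnes_cooper (R : realType) (n q m : nat)
    (A : 'M[R]_(m, n)) (B : 'M[R]_(m, q)) (b : 'cV[R]_m)
    (r u : 'I_n -> R) (u0 : R) (x : 'cV[R]_n) (z : 'cV[R]_q)
    (t := (u0 + weight u x)^-1) :
  0 < u0 + weight u x -> A *m x + B *m z <=v b ->
  lp_feasible A B b u u0 (t, t *: x, t *: z) /\
  lp_objective r u (t, t *: x, t *: z) = expected_revenue r u u0 x.
Proof.
move=> D_gt0 xz.
have t_ge0 : 0 <= t by rewrite invr_ge0 ltW.
split; last first.
  transitivity (weight (fun j => r j * u j) (t *: x)); first by [].
  by rewrite linearZ /= mulrC.
split=> //.
  by rewrite -!scalemxAr -scalerDr; apply: le_cvZ.
transitivity (u0 * t + weight u (t *: x)); first by [].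
by rewrite linearZ /= mulrC -mulrDr mulVf // lt0r_neq0.
Qed.

Theorem corollary3 (R : realType) (n k q m : nat)
    (r u : 'I_n -> R) (u0 : R) (C : 'M[R]_(k, n)) (d : 'cV[R]_k)
    (A : 'M[R]_(m, n)) (B : 'M[R]_(m, q)) (b : 'cV[R]_m) (p : {poly nat})
    (u_ge0 : forall j, 0 <= u j) (u0_gt0 : 0 < u0)
    (nonempty : assortments C d !=set0)
    (compact : compact_extended_formulation p A B b
                 (convex_hull (assortments C d))) :
  exists v : R,
    is_max_value (expected_revenue r u u0) (assortments C d) v /\
    is_max_value (lp_objective r u) (lp_feasible A B b u u0) v.
Proof.
have [defP _] := compact.
pose D x := u0 + weight u x.
have D_gt0 x : assortments C d x -> 0 < D x.
  move=> [_ xbin]; rewrite ltr_wpDr // sumr_ge0 // => j _.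
  by rewrite mulr_ge0 //; case: (xbin j) => ->.
have [x' Sx' x'max] := @binary_argmax _ _ (assortments C d)
  (expected_revenue r u u0) (fun x Sx => Sx.2) nonempty.
have Px' : convex_hull (assortments C d) x' by apply: sub_gen_smallest.
set v := expected_revenue r u u0 x'.
exists v; split.
  by split=> [|_ [x Sx <-]]; [exists x' | apply: x'max].
split.
  have [z' xz'] : exists z', A *m x' + B *m z' <=v b.
    by move: Px'; rewrite {1}defP.
  have [feas obj] := charnes_cooper r (D_gt0 _ Sx') xz'.
  by exists ((D x')^-1, (D x')^-1 *: x', (D x')^-1 *: z').
move=> _ [[[y0 y] z] [yz y0_ge0 norm1] <-].
pose ru j := r j * u j.
pose c j := ru j - v * u j.
have revE x : expected_revenue r u u0 x = weight ru x / D x by [].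
have Sle x : assortments C d x -> weight c x <= v * u0.
  move=> Sx; have := x'max _ Sx; rewrite -/v revE ler_pdivrMr ?D_gt0 //.
  by rewrite weight_lin /D mulrDr lerBlDr.
have cx' : weight c x' = v * u0.
  apply/eqP; rewrite weight_lin subr_eq -mulrDr.
  by rewrite /v revE divfK // lt0r_neq0 // D_gt0.
have := homogenized_weight_le defP (convex_hull_weight_le Sle) Px' cx'
  y0_ge0 yz.
rewrite weight_lin lerBlDr -mulrA -mulrDr.
by rewrite [X in v * X]norm1 mulr1.
Qed.
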